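(* Let $n\ge1$, $k\ge0$ and $l\ge0$ be integers with $\frac{l}{l+1} < \frac{k}{n} < \frac{l+1}{l+2}$. Then the inclusion $\partial C_{2l+2}(n) \hookrightarrow \mathcal{N}(n,k)$ (for the natural ordering of the vertices $0,\dots,n-1$) is a homotopy equivalence.
   Context: For $n\ge1$ and integers $i\le j$, $[i,j]_n$ is the image of $\{i,i+1,\dots,j\}$ under $\mathbb{Z}\to\mathbb{Z}/n$. The nerve complex $\mathcal{N}(n,k)$ is the simplicial complex with vertex set $\{0,\dots,n-1\}$ (identified with $\mathbb{Z}/n$) whose maximal simplices are the sets $[i,i+k]_n$, $i=0,\dots,n-1$. For $n>d$, the cyclic polytope $C_d(n)$ is $\mathrm{conv}\{\gamma(0),\dots,\gamma(n-1)\}\subset\mathbb{R}^d$, where $\gamma(t)=(t,t^2,\dots,t^d)$. It is a simplicial polytope; labelling the vertex $\gamma(i)$ by $i$, its boundary complex $\partial C_d(n)$ is regarded as an abstract simplicial complex on $\{0,\dots,n-1\}$. For $d$ even, by Gale's evenness condition the maximal simplices of $\partial C_d(n)$ are exactly the $d$-element subsets that are disjoint unions of $d/2$ sets of the form $[i,i+1]_n$. The hypothesis on $k/n$ implies $n\ge 2l+3$, so $C_{2l+2}(n)$ is defined, and $\partial C_{2l+2}(n)$ is a subcomplex of $\mathcal{N}(n,k)$. Simplicial complexes are identified with their geometric realizations. *)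

(* Defs.v *)
From HB Require Import structures.
From mathcomp Require Import all_boot all_order all_algebra.
From mathcomp Require Import all_classical all_reals all_analysis.
Set Implicit Arguments.
Unset Strict Implicit.
Unset Printing Implicit Defensive.
Import Order.TTheory GRing.Theory Num.Theory.
Import numFieldNormedType.Exports.
Local Open Scope classical_set_scope.
Local Open Scope ring_scope.

Section Homotopy.
Context {R : realType}.

(* The homotopy is only constrained on the cylinder X x [0, 1]: its values at
   times outside [0, 1] are irrelevant. *)
Definition homotopic {X Y : topologicalType} (f g : X -> Y) : Prop :=
  exists H : X * R -> Y,
    [/\ {within [set: X] `*` `[0%R, 1%R], continuous H},
        forall x, H (x, 0) = f x & forall x, H (x, 1) = g x].

Definition homotopy_equivalence {X Y : topologicalType} (f : X -> Y) : Prop :=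
  continuous f /\
  exists g : Y -> X,
    [/\ continuous g, homotopic (g \o f) id & homotopic (f \o g) id].

End Homotopy.
Arguments homotopic R {X Y} f g.
Arguments homotopy_equivalence R {X Y} f.

Record simplicial_complex (n : nat) := SimplicialComplex {
  simplices :> set {set 'I_n};
  simplices_sub : forall s t : {set 'I_n},
    simplices s -> t \subset s -> simplices t
}.

(* Barycentric coordinates; the empty set, which may or may not belong to K,
   contributes no point since the coordinates sum to 1. *)
Definition realization_set (R : realType) n (K : simplicial_complex n)
    : set 'rV[R]_n :=
  [set x | [/\ forall i, 0 <= x 0 i, \sum_i x 0 i = 1
             & simplices K [set i | x 0 i != 0]%SET]].
Arguments realization_set R {n} K.

Definition realization (R : realType) n (K : simplicial_complex n)
    : topologicalType := set_type (realization_set R K).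
Arguments realization R {n} K.

Lemma realization_set_sub (R : realType) n (K L : simplicial_complex n) :
  simplices K `<=` simplices L -> realization_set R K `<=` realization_set R L.
Proof. by move=> KL x [x0 x1 Kx]; split=> //; exact: KL. Qed.

Definition realization_incl (R : realType) n (K L : simplicial_complex n)
    (KL : simplices K `<=` simplices L) : realization R K -> realization R L :=
  subfun (@realization_set_sub R n K L KL).
Arguments realization_incl R {n K L} KL.

Section Nerve.
Variable n : nat.

(* Elements of Z/n are represented by their residues in 'I_n. *)
Definition cyclic_interval (i j : nat) : {set 'I_n} :=
  [set x : 'I_n | [exists m : 'I_j.+1, (i <= m)%N && (m == x %[mod n])]]%SET.

Definition nerve_simplices (k : nat) : set {set 'I_n} :=
  [set s | exists i : 'I_n, s \subset cyclic_interval i (i + k)].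

Lemma nerve_simplices_sub k (s t : {set 'I_n}) :
  nerve_simplices k s -> t \subset s -> nerve_simplices k t.
Proof. by move=> [i si] ts; exists i; exact: fintype.subset_trans si. Qed.

Definition nerve_complex (k : nat) : simplicial_complex n :=
  SimplicialComplex (@nerve_simplices_sub k).

End Nerve.

Definition convex_hull {R : numDomainType} {V : lmodType R} (A : set V) :
  set V := smallest (@convex_set R V) A.

(* Faces are cut out by valid linear inequalities; P itself and the empty set
   (f = 0 with b = 0, resp. b = 1) are faces. *)
Definition is_face {R : numDomainType} {V : lmodType R} (P F : set V) : Prop :=
  exists (f : {scalar V}) (b : R),
    (forall x, P x -> f x <= b) /\ F = P `&` [set x | f x = b].

Definition is_proper_face {R : numDomainType} {V : lmodType R}
  (P F : set V) : Prop := is_face P F /\ F <> P.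

Section CyclicPolytope.
Variables (R : realType) (d n : nat).

Definition moment_curve (t : R) : 'rV[R]_d := \row_(j < d) t ^+ j.+1.

Definition cyclic_polytope : set 'rV[R]_d :=
  convex_hull [set moment_curve i%:R | i in [set: 'I_n]].

Definition cyclic_boundary_simplices : set {set 'I_n} :=
  [set s | exists F : set 'rV[R]_d, is_proper_face cyclic_polytope F /\
     forall i : 'I_n, i \in s <-> F (moment_curve i%:R)].

Lemma cyclic_polytope_vertex (i : 'I_n) : cyclic_polytope (moment_curve i%:R).
Proof. by apply: sub_gen_smallest; exists i. Qed.

Lemma cyclic_polytope_ind (C : set 'rV[R]_d) :
  @convex_set R _ C -> (forall i : 'I_n, C (moment_curve i%:R)) ->
  cyclic_polytope `<=` C.
Proof. by move=> cC Cv; apply: smallest_sub => // _ [i _ <-]; exact: Cv. Qed.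

Lemma convex_set_scalar_le (f : {scalar 'rV[R]_d}) (b : R) :
  @convex_set R _ [set x : 'rV[R]_d | f x <= b].
Proof.
move=> x y l; rewrite !inE /= => fx fy.
have: 0 <= l%:inum <= 1 by apply/andP.
set t : R := l%:inum => /andP[t0 t1].
have -> : f (conv l x y) = t * f x + (1 - t) * f y.
  by rewrite [conv _ _ _]/(t *: x + (1 - t) *: y) linearD !linearZ.
have -> : b = t * b + (1 - t) * b by rewrite -mulrDl subrKC mul1r.
by rewrite lerD// ler_wpM2l// subr_ge0.
Qed.

(* Affine functions restricted to the moment curve are polynomials of degree
   at most d. *)
Lemma cyclic_boundary_simplicesP (s : {set 'I_n}) :
  cyclic_boundary_simplices s <->
  exists q : {poly R}, [/\ (size q <= d.+1)%N,
    forall i : 'I_n, q.[i%:R] <= 0,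
    forall i : 'I_n, (i \in s) = (q.[i%:R] == 0) & s != [set: 'I_n]%SET].
Proof.
split=> [[F [[[f [b [fb FE]]] FP] sF]]|[q [qd q0 qs sT]]].
  pose q := \sum_(j < d) (f (delta_mx 0 j)) *: 'X^(j.+1) - b%:P.
  have qE t : q.[t] = f (moment_curve t) - b.
    rewrite /q !hornerE horner_sum; congr (_ - _).
    rewrite [moment_curve t]row_sum_delta linear_sum; apply: eq_bigr => j _.
    by rewrite linearZ /= mxE hornerZ hornerXn mulrC.
  exists q; split.
  - rewrite (leq_trans (size_polyD _ _))// geq_max; apply/andP; split.
      apply: (leq_trans (size_sum _ _ _)); apply/bigmax_leqP => j _.
      by rewrite (leq_trans (size_scale_leq _ _))// size_polyXn !ltnS.
    by rewrite size_polyN (leq_trans (size_polyC_leq1 _)).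
  - by move=> i; rewrite qE subr_le0 fb//; exact: cyclic_polytope_vertex.
  - move=> i; rewrite qE subr_eq0; apply/idP/eqP => [/sF|fib].
      by rewrite FE => -[].
    by apply/sF; rewrite FE; split=> //; exact: cyclic_polytope_vertex.
  - apply: contra_notN FP => /eqP sT.
    rewrite FE; apply/seteqP; split=> [x []//|x Px]; split=> //=.
    apply/eqP; rewrite eq_le fb//= -lerN2.
    suff : [set x | (-%R \o f : {scalar _}) x <= - b] x by [].
    move: x Px; apply: cyclic_polytope_ind; first exact: convex_set_scalar_le.
    move=> i /=; have /sF : i \in s by rewrite sT inE.
    by rewrite FE => -[_ /= ->].
have [f fE] : exists f : {scalar 'rV[R]_d},
    forall t, f (moment_curve t) = q.[t] - q`_0.
  exists (mxtrace \o mulmxr (\col_(j < d) q`_(j.+1)%R)) => t.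
  rewrite /= trace_mx11 mxE (horner_coef_wide t qd) big_ord_recl /=.
  rewrite expr0 mulr1 addrC addKr; apply: eq_bigr => j _.
  by rewrite !mxE mulrC.
exists (cyclic_polytope `&` [set x | f x = - q`_0]); split; first split.
- exists f, (- q`_0); split=> //.
  apply: cyclic_polytope_ind; first exact: convex_set_scalar_le.
  by move=> i /=; rewrite fE gerDr.
- move=> FP; move/negP: sT; apply; apply/eqP/setP => i; rewrite inE qs.
  have := cyclic_polytope_vertex i; rewrite -FP => -[_ /= /eqP].
  by rewrite fE -subr_eq0 opprK subrK.
- move=> i; rewrite qs; split=> [/eqP qi|[_ /= /eqP]].
    by split; [exact: cyclic_polytope_vertex | rewrite /= fE qi sub0r].
  by rewrite fE -subr_eq0 opprK subrK.
Qed.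

(* C_d(n) is simplicial: a polynomial of degree at most d exposing s is
   perturbed so that it exposes s minus a vertex. *)
Lemma cyclic_boundary_simplices_sub (s t : {set 'I_n}) :
  cyclic_boundary_simplices s -> t \subset s -> cyclic_boundary_simplices t.
Proof.
suff D1 (u : {set 'I_n}) i :
    cyclic_boundary_simplices u -> cyclic_boundary_simplices (u :\ i)%SET.
  move=> + ts; have [m] := ubnP #|s :\: t|%SET.
  elim: m s ts => // m IHm s ts; rewrite ltnS => lem bs.
  have [st|/subsetPn[i si ti]] := boolP (s \subset t).
    by have -> : t = s by apply/eqP; rewrite finset.eqEsubset ts.
  apply: (IHm (s :\ i)%SET); last exact: D1.
    by rewrite finset.subsetD1 ts.
  rewrite finset.setDDl finset.setUC -finset.setDDl.
  by move: lem; rewrite (cardsD1 i) !inE si ti.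
have [ui|ui] := boolP (i \in u); last first.
  by have -> : (u :\ i)%SET = u by apply/finset.setDidPl; rewrite disjoint_sym disjoints1.
move=> /cyclic_boundary_simplicesP[q [qd q0 qu uT]].
have [j ju] : exists j, j \notin u.
  by apply/existsP; rewrite -negb_forall; apply: contra uT => /forallP uA;
    apply/eqP/setP => j; rewrite inE uA.
have qn0 : q != 0 by apply: contraNneq ju => q_0; rewrite qu q_0 horner0.
pose pts (A : {set 'I_n}) : seq R := [seq k%:R | k : 'I_n in A].
have ptsE (A : {set 'I_n}) (k : 'I_n) : (k%:R \in pts A) = (k \in A).
  apply/idP/idP => [/fintype.imageP[h hA /eqP]|kA]; last by apply/fintype.imageP; exists k.
  by rewrite eqr_nat => /eqP kh; have -> : k = h by exact: val_inj.
have ptsU (A : {set 'I_n}) : uniq (pts A).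
  by rewrite map_inj_uniq ?enum_uniq// => x y /eqP; rewrite eqr_nat => /eqP /val_inj.
have ud : (#|u| <= d)%N.
  rewrite -ltnS -(size_image (fun k : 'I_n => k%:R : R)).
  rewrite (leq_trans _ qd)// max_poly_roots//; last exact: ptsU.
  by apply/allP => _ /fintype.imageP[k ku ->]; rewrite rootE -qu.
pose e : {poly R} := \prod_(x <- pts (u :\ i)%SET) ('X - x%:P).
have eE (k : 'I_n) : (e.[k%:R] == 0) = (k \in (u :\ i)%SET).
  by rewrite -rootE root_prod_XsubC ptsE.
have ed : (size e <= d.+1)%N.
  rewrite size_prod_XsubC size_image ltnS (leq_trans _ ud)//.
  exact/subset_leq_card/subD1set.
pose M := 1 + \sum_(k < n) `|e.[i%:R] * e.[k%:R] / q.[k%:R]|.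
have Mk (k : 'I_n) : k \notin u -> M * q.[k%:R] - e.[i%:R] * e.[k%:R] < 0.
  rewrite qu => qk; have qk0 : q.[k%:R] < 0 by rewrite lt_neqAle qk q0.
  rewrite subr_lt0 -ltr_ndivrMr//.
  rewrite (le_lt_trans (ler_norm _))// /M (bigD1 k)//= addrCA ltrDl.
  by rewrite ltr_pwDl// sumr_ge0.
have Mu (k : 'I_n) : k \in u -> k != i ->
    M * q.[k%:R] - e.[i%:R] * e.[k%:R] = 0.
  move=> ku ki; have /eqP -> : e.[k%:R] == 0 by rewrite eE !inE ki.
  by move: ku; rewrite qu => /eqP ->; rewrite !mulr0 subr0.
have Mi : M * q.[i%:R] - e.[i%:R] * e.[i%:R] < 0.
  move: (ui); rewrite qu => /eqP ->; rewrite mulr0 sub0r oppr_lt0 -expr2.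
  by rewrite exprn_even_gt0//= eE !inE eqxx.
apply/cyclic_boundary_simplicesP; exists (M *: q - e.[i%:R] *: e).
split.
- rewrite (leq_trans (size_polyD _ _))// geq_max size_polyN.
  by rewrite !(leq_trans (size_scale_leq _ _)).
- move=> k; rewrite !hornerE.
  have [->|ki] := eqVneq k i; first exact: ltW.
  by have [ku|ku] := boolP (k \in u); [rewrite Mu | exact/ltW/Mk].
- move=> k; rewrite !hornerE !inE.
  have [->|ki] /= := eqVneq k i; first by rewrite lt_eqF.
  by have [ku|ku] := boolP (k \in u); [rewrite Mu ?eqxx | rewrite lt_eqF ?Mk].
- by apply: contraNneq ju => uiT; have := finset.in_setT j;
    rewrite -uiT !inE => /andP[].
Qed.

Definition cyclic_boundary_complex : simplicial_complex n :=
  SimplicialComplex cyclic_boundary_simplices_sub.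

End CyclicPolytope.

(* Main.v *)
Require Import Defs.
From mathcomp Require Import all_boot all_order all_algebra.
From mathcomp Require Import all_classical all_reals all_analysis.
From mathcomp Require Import lra zify.
Import Order.TTheory GRing.Theory Num.Theory.
Import numFieldNormedType.Exports.
Local Open Scope classical_set_scope.
Local Open Scope ring_scope.

Set Implicit Arguments.
Unset Strict Implicit.
Unset Printing Implicit Defensive.

(** Write g = n - k; the hypotheses say (l+1) g < n < (l+2) g.  Measure the gaps
of a set s of residues mod n by the difference of cyclically consecutive
elements.  Then s is a simplex of the nerve complex exactly when it has a gap
of length at least g, and s is a face of the cyclic polytope of dimension
2l + 2 exactly when at most l + 1 cyclic edges {a, a+1} cover it.  So the
nerve complex is the case h = g of the complexes K_h of all sets that have a
gap of length at least h or are coverable by l + 1 edges (since (l+1) g < n, a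
set covered by l + 1 edges has a gap of length at least g), while K_n is the
boundary of the cyclic polytope.  The theorem
follows once K_h deformation retracts onto K_(h+1) for g <= h < n.

To pass from K_(h+1) to K_h, adjoin one facet at a time: for x = 0, ..., n-1,
the complement F of the open gap ]x, x+h[.  A set in F that is new at this
step contains x and x+h.  Cover such an s greedily by edges {q_j, q_j + 1},
starting with q_0 = x+h and letting q_(j+1) be the first element of s beyond
q_j + 1.  Toggling p_j = q_j + 1 affects neither the greedy covering nor the
other gaps, so s with p_j toggled is again new, unless removing p_j merges two
gaps into one that is too long; this pins down q_(j+1) as a number that depends
only on x and j.  Hence all new sets can be collapsed by toggling p_0, then
p_1, and so on.  If every toggle failed, then s would be covered by the edges
{q_j, p_j}, whose left ends are at distance at least h from one another; as
(l+2) h > n there would be at most l + 1 of them, and s would not be new.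

Each toggle is a deformation retraction (toggle_collapse), given by an
explicit formula.  The remaining ingredient is Gale's evenness condition:
a product of the quadratics (X - a)(X - a - 1), with the sign changed for the
edge {n-1, 0}, is nonnegative at 0, ..., n-1 and exposes the union of the edges;
conversely an exposed set that needs more edges contradicts a Lagrange
interpolation identity whose terms all have the same sign. *)

(** * Deformation retractions between realizations *)

Definition down_closed n (P : set {set 'I_n}) : Prop :=
  forall s t : {set 'I_n}, P s -> t \subset s -> P t.

Lemma continuous_pair (T U V : topologicalType) (f : T -> U) (g : T -> V) :
  continuous f -> continuous g -> continuous (fun z => (f z, g z)).
Proof.
move=> cf cg z.
by apply: (cvg_pair (G := nbhs (f z)) (H := nbhs (g z))); [exact: cf|exact: cg].
Qed.

Section Deformation.
Variables (R : realType) (n : nat).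
Implicit Types (P Q M : set {set 'I_n}) (x y : 'rV[R]_n) (s t : R).

Definition carrier x : {set 'I_n} := [set i | x 0 i != 0]%SET.

(** The realization of P, for a family P that need not be known to be closed
under subsets. *)
Definition points P : set 'rV[R]_n :=
  [set x : 'rV[R]_n | [/\ forall i, 0 <= x 0 i, \sum_i x 0 i = 1 & P (carrier x)]].

Lemma points_sub P Q : P `<=` Q -> points P `<=` points Q.
Proof. by move=> PQ x [x0 x1 Px]; split=> //; exact: PQ. Qed.

(** The homotopy is defined and continuous on the whole space, and starts at
the identity on the full simplex: this allows retractions to be concatenated
without gluing continuous maps along closed subsets. *)
Definition deformation_retract P Q : Prop :=
  P `<=` Q /\ exists H : 'rV[R]_n * R -> 'rV[R]_n,
    [/\ continuous H,
        forall x, points [set: {set 'I_n}] x -> H (x, 0) = x,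
        forall x s, points P x -> H (x, s) = x,
        forall x s, points Q x -> 0 <= s <= 1 -> points Q (H (x, s))
      & forall x, points Q x -> points P (H (x, 1))].

Lemma deformation_retract_refl P : deformation_retract P P.
Proof.
split=> //; exists fst; split=> //.
by move=> x; exact: cvg_fst.
Qed.

Definition clamp s : R := Num.max 0 (Num.min s 1).

Lemma clamp01 s : 0 <= clamp s <= 1.
Proof. by rewrite /clamp le_max lexx /= ge_max ler01 ge_min lexx orbT. Qed.

Lemma clamp_le0 s : s <= 0 -> clamp s = 0.
Proof. by move=> s0; rewrite /clamp max_l// ge_min s0. Qed.

Lemma clamp_ge1 s : 1 <= s -> clamp s = 1.
Proof. by move=> s1; rewrite /clamp min_r// max_r. Qed.

Lemma continuous_clamp (T : topologicalType) (f : T -> R) :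
  continuous f -> continuous (fun z => clamp (f z)).
Proof.
move=> cf; apply: max_fun_continuous; first by move=> z; exact: cvg_cst.
by apply: min_fun_continuous => // z; exact: cvg_cst.
Qed.

(** The homotopies are run one after the other, with the time of each clamped
to [0, 1]: while the outer one waits it acts as the identity. *)
Lemma deformation_retract_trans P Q M :
  deformation_retract P Q -> deformation_retract Q M ->
  deformation_retract P M.
Proof.
move=> [PQ [H1 [c1 H10 H1P H1Q H11]]] [QM [H2 [c2 H20 H2Q H2M H21]]].
split; first exact: subset_trans QM.
pose a (z : 'rV[R]_n * R) := H2 (z.1, clamp (2 * z.2)).
have inT N x : points N x -> points setT x by apply: points_sub.
exists (fun z => H1 (a z, clamp (2 * z.2 - 1))); split.
- have c2z : continuous (fun z : 'rV[R]_n * R => 2 * z.2 : R).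
    by move=> z; apply: cvgM; [exact: cvg_cst | exact: cvg_snd].
  have ca : continuous a.
    move=> z; apply: (@continuous_comp _ _ _
      (fun z : 'rV[R]_n * R => (z.1, clamp (2 * z.2))) H2); last exact: c2.
    apply: continuous_pair; last exact: continuous_clamp c2z.
    by move=> u; exact: cvg_fst.
  move=> z; apply: (@continuous_comp _ _ _
      (fun z : 'rV[R]_n * R => (a z, clamp (2 * z.2 - 1))) H1); last exact: c1.
  apply: continuous_pair; first exact: ca.
  apply: (@continuous_clamp _ (fun z : 'rV[R]_n * R => 2 * z.2 - 1)) => u.
  by apply: cvgB; [exact: c2z | exact: cvg_cst].
- move=> x xT; rewrite /a /= mulr0 !clamp_le0 ?sub0r ?oppr_le0//.
  by rewrite H20// H10.
- by move=> x s xP; rewrite /a /= H2Q ?H1P//; exact: points_sub xP.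
- move=> x s xM /andP[s0 s1]; rewrite /a /=.
  have [s2|s2] := leP (2 * s) 1.
    rewrite (@clamp_le0 (2 * s - 1)) ?subr_le0//.
    have yM := H2M x _ xM (clamp01 (2 * s)).
    by rewrite H10//; exact: inT yM.
  rewrite (clamp_ge1 (ltW s2)); apply: points_sub QM _ _.
  by apply: H1Q; [exact: H21 | exact: clamp01].
- move=> x xM; rewrite /a /= mulr1 clamp_ge1 ?ler1n// clamp_ge1; last by lra.
  by apply: H11; exact: H21.
Qed.

Lemma continuous_row (T : topologicalType) (f : T -> 'rV[R]_n) :
  (forall i, continuous (fun z => f z 0 i)) -> continuous f.
Proof.
move=> cf z A [P Pz PA].
have : \forall u \near z, forall i, P 0 i (f u 0 i).
  by apply: filter_forall => i; apply: cf; exact: Pz.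
by apply: filterS => u Pu; apply: PA => i j; rewrite ord1.
Qed.

(** The least height at which all coordinates that exceed it belong to a common
simplex of P.  As a minimum of maxima of coordinates it is continuous, and it
vanishes on the realization of P. *)
Definition level P x : R :=
  \big[Num.min/1]_(s : {set 'I_n} | `[<P s>])
    \big[Num.max/0]_(i | i \notin s) x 0 i.

Lemma continuous_level P : continuous (level P).
Proof.
apply: continuous_big; first exact: min_continuous.
move=> s _; apply: continuous_big; first exact: max_continuous.
by move=> i _; exact: coord_continuous.
Qed.

Lemma level_ge0 P x : 0 <= level P x.
Proof.
rewrite /level; elim/big_ind: _ => //; first by move=> a b a0 b0; rewrite le_min a0.
by move=> s _; exact: bigmax_ge_id.
Qed.

Lemma level_points P x : points P x -> level P x = 0.
Proof.
move=> [x0 _ Px]; apply: le_anti; rewrite level_ge0 andbT.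
apply: (le_trans (bigmin_le_cond _ _ (j := carrier x) _)); first exact/asboolP.
by apply/bigmax_leP; split=> // i; rewrite inE negbK => /eqP ->.
Qed.

Lemma level_above P x : down_closed P -> P finset.set0 ->
  points setT x -> P [set i | level P x < x 0 i]%SET.
Proof.
move=> dP P0 [x0 x1 _]; rewrite /level; elim/big_ind: _ => [|a b Pa Pb|s Ps].
- apply: (dP _ _ P0); apply/fintype.subsetP => i; rewrite inE ltNge => /negP[].
  by rewrite -x1 (bigD1 i)//= lerDl sumr_ge0.
- by rewrite minElt; case: ifP.
- apply: (dP s); first exact/asboolP.
  apply/fintype.subsetP => i; rewrite inE; apply: contraTT => si.
  by rewrite -leNgt; exact: le_bigmax_cond.
Qed.

(** At time s, lower all coordinates other than p by s * level P x, stopping at 0,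
and give the mass that is lost to p. *)
Definition push P p (z : 'rV[R]_n * R) : 'rV[R]_n :=
  \row_i if i == p then
           1 - \sum_(j | j != p) Num.max 0 (z.1 0 j - z.2 * level P z.1)
         else Num.max 0 (z.1 0 i - z.2 * level P z.1).

Lemma continuous_push P p : continuous (push P p).
Proof.
have ct i : continuous (fun z : 'rV[R]_n * R =>
    Num.max 0 (z.1 0 i - z.2 * level P z.1)).
  apply: max_fun_continuous; first by move=> z; exact: cvg_cst.
  move=> z; apply: cvgB.
    apply: (@continuous_comp _ _ _ fst (fun x : 'rV[R]_n => x 0 i)).
      exact: cvg_fst.
    exact: coord_continuous.
  apply: cvgM; first exact: cvg_snd.
  apply: (@continuous_comp _ _ _ fst (level P)); first exact: cvg_fst.
  exact: continuous_level.
apply: continuous_row => i.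
rewrite (_ : (fun z => _) = (fun z : 'rV[R]_n * R => if i == p then
    1 - \sum_(j | j != p) Num.max 0 (z.1 0 j - z.2 * level P z.1)
    else Num.max 0 (z.1 0 i - z.2 * level P z.1))); last first.
  by apply/funext => z; rewrite mxE.
have [_|_] := eqVneq i p; last exact: ct.
move=> z; apply: cvgB; first exact: cvg_cst.
by apply: (@continuous_big _ _ _ _ _ (@add_continuous R)) => j _; exact: ct.
Qed.

Lemma push_id P p x s : points setT x -> s * level P x = 0 -> push P p (x, s) = x.
Proof.
move=> [x0 x1 _] sl; apply/rowP => i; rewrite !mxE /= sl.
have mx j : Num.max 0 (x 0 j - 0) = x 0 j by rewrite subr0 max_r.
rewrite mx; case: eqP => // ->.
under eq_bigr do rewrite mx.
by rewrite -x1 (bigD1 p)//= addrK.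
Qed.

Lemma push_points P p x s : points setT x -> 0 <= s ->
  points setT (push P p (x, s)) /\
  carrier (push P p (x, s)) \subset
    (p |: [set i | (s * level P x < x 0 i)%R])%SET.
Proof.
move=> [x0 x1 _] s0; set t := s * level P x.
have t0 : 0 <= t by rewrite mulr_ge0// level_ge0.
have mx j : Num.max 0 (x 0 j - t) <= x 0 j by rewrite ge_max x0 gerBl.
split; last first.
  apply/fintype.subsetP => i; rewrite !inE mxE /=; case: (eqVneq i p) => //= _.
  by apply: contraNT; rewrite -leNgt => xt; rewrite max_l// subr_le0.
split=> //.
- move=> i; rewrite mxE; case: eqP => _; last by rewrite le_max lexx.
  rewrite subr_ge0 -x1 [leRHS](bigD1 p)//=.
  apply: le_trans (_ : \sum_(j | j != p) x 0 j <= _).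
    by apply: ler_sum => j _; exact: mx.
  by rewrite lerDr.
- rewrite (bigD1 p)//= !mxE eqxx /=.
  under [X in _ + X]eq_bigr => j jp do rewrite mxE (negPf jp).
  by rewrite subrK.
Qed.

(** If the sets in Q but not in P come in pairs that differ by p, then Q retracts
onto P by pushing towards p: on a simplex of Q outside P, the coordinates other
than p sink until those that survive form, together with p, a simplex of P, and
by the pairing this happens exactly at the height level P x. *)
Lemma toggle_collapse P Q (p : 'I_n) : down_closed P -> down_closed Q ->
  P finset.set0 -> P `<=` Q ->
  (forall s : {set 'I_n}, Q s -> ~ P s -> Q (p |: s)%SET /\ ~ P (s :\ p)%SET) ->
  deformation_retract P Q.
Proof.
move=> dP dQ P0 PQ tog; split=> //; exists (push P p); split.
- exact: continuous_push.
- by move=> x xT; rewrite push_id// mul0r.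
- move=> x s xP; rewrite push_id//; first exact: points_sub xP.
  by rewrite level_points// mulr0.
- move=> x s xQ /andP[s0 _].
  have xT : points setT x by exact: points_sub xQ.
  have [Px|Px] := pselect (P (carrier x)).
    have xP : points P x by case: xQ.
    by rewrite push_id// level_points ?mulr0.
  have [[y0 y1 _] ys] := push_points P p xT s0.
  case: xQ => x0 _ Qx.
  split=> //; have [Qpx _] := tog _ Qx Px; apply: dQ Qpx _.
  apply: (fintype.subset_trans ys); apply: finset.setUS.
  apply/fintype.subsetP => i; rewrite !inE.
  apply: contraTN => /eqP ->; rewrite -leNgt mulr_ge0// level_ge0//.
- move=> x xQ.
  have xT : points setT x by exact: points_sub xQ.
  have [Px|Px] := pselect (P (carrier x)).
    have xP : points P x by case: xQ.
    by rewrite push_id// level_points ?mulr0.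
  have [[y0 y1 _] ys] := push_points P p xT ler01.
  case: xQ => x0 _ Qx.
  split=> //; have [Qpx _] := tog _ Qx Px; apply: (dP _ _ _ ys).
  rewrite mul1r; have Pm := level_above dP P0 xT.
  set u := [set i | _]%SET in Pm *.
  have us : u \subset carrier x.
    apply/fintype.subsetP => i; rewrite !inE; apply: contraTN => /eqP ->.
    by rewrite -leNgt level_ge0.
  apply: contrapT => Ppu.
  have [] := tog (p |: u)%SET _ Ppu; first by apply: (dQ _ _ Qpx); exact: finset.setUS.
  by move=> _; apply; apply: dP Pm _; apply/fintype.subsetP => i; rewrite !inE; case: eqP.
Qed.

End Deformation.

Lemma homotopy_equivalence_incl (R : realType) n (K L : simplicial_complex n)
    (KL : simplices K `<=` simplices L) :
  deformation_retract R (simplices K) (simplices L) ->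
  homotopy_equivalence R (realization_incl R KL).
Proof.
move=> [_ [H [cH H0 HK HL H1]]].
have pL (y : realization R L) : points (simplices L) (val y) := set_valP y.
have pK (y : realization R K) : points (simplices K) (val y) := set_valP y.
have pT (P : set {set 'I_n}) (x : 'rV[R]_n) : points P x -> points setT x.
  exact: points_sub.
have cval (M : simplicial_complex n) :
    continuous (val : realization R M -> 'rV[R]_n).
  exact: initial_continuous.
split.
  apply: continuous_comp_initial => /=.
  exact: (cval K).
pose g (y : realization R L) : realization R K :=
  SigSub (mem_set (H1 _ (pL y))).
exists g; split.
- apply: continuous_comp_initial => /= y.
  apply: (@continuous_comp _ _ _
    (fun y : realization R L => (val y : 'rV[R]_n, 1 : R)) H); last exact: cH.
  apply: continuous_pair; first exact: cval.
  exact: cst_continuous.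
- exists fst; split=> //.
    by apply: continuous_subspaceT => z; exact: cvg_fst.
  by move=> x; apply: val_inj; rewrite /= HK; [|exact: pK].
- pose h (z : realization R L * R) : realization R L :=
    SigSub (mem_set (HL _ _ (pL z.1) (clamp01 (1 - z.2)))).
  exists h; split.
  + apply: continuous_subspaceT; apply: continuous_comp_initial => /= z.
    apply: (@continuous_comp _ _ _ (fun z : realization R L * R =>
      (val z.1 : 'rV[R]_n, clamp (1 - z.2))) H); last exact: cH.
    apply: continuous_pair.
      move=> u; apply: (@continuous_comp _ _ _ fst
        (val : realization R L -> 'rV[R]_n)); first exact: cvg_fst.
      exact: cval.
    apply: (@continuous_clamp _ _ (fun z : realization R L * R => 1 - z.2)).
    by move=> u; apply: cvgB; [exact: cvg_cst | exact: cvg_snd].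
  + move=> x; apply: val_inj; rewrite /= subr0 clamp_ge1//.
  + by move=> x; apply: val_inj; rewrite /= subrr clamp_le0// H0//; exact/pT/pL.
Qed.

(** * Sets covered by cyclic edges, and sets with a long gap *)

Definition edge_span n (A : {set 'I_n}) : {set 'I_n} :=
  (A :|: [set ordS a | a in A])%SET.

Definition edge_coverable n c (s : {set 'I_n}) : Prop :=
  exists2 A : {set 'I_n}, (#|A| <= c)%N & s \subset edge_span A.

Lemma edge_coverable_sub n c (s t : {set 'I_n}) :
  edge_coverable c s -> t \subset s -> edge_coverable c t.
Proof. by move=> [A Ac sA] ts; exists A => //; exact: fintype.subset_trans sA. Qed.

Section Stages.
Local Open Scope nat_scope.
Variables (N l : nat).
Let n := N.+1.
Let z (m : nat) : 'I_n := inZp m.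
Implicit Types (s t : {set 'I_n}) (q m c h x : nat).

Lemma inZp_eq a b : (z a == z b) = (a == b %[mod n]).
Proof. by []. Qed.

Lemma inZp_addn a c : z (a + c * n) = z a.
Proof. by apply/eqP; rewrite inZp_eq addnC modnMDl. Qed.

Lemma inZp_neq a b : a < b < a + n -> z b != z a.
Proof.
move=> /andP[ab ban]; rewrite inZp_eq eqn_mod_dvd; last exact: ltnW.
by rewrite gtnNdvd ?subn_gt0// ltn_subLR// ltnW.
Qed.

Lemma ordS_inZp m : ordS (z m) = z m.+1.
Proof. by apply: val_inj; rewrite /= -addn1 modnDml addn1. Qed.

(** If z m is not the left end of an edge of the covering, then it is the right
end of an edge that starts at z m.-1, and this edge can be moved one step to the
right. *)
Lemma edge_shift c s m : 0 < m -> z m \in s -> edge_coverable c s ->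
  edge_coverable c (z m.+1 |: s :\ z m.-1)%SET.
Proof.
move=> m0 ms [A Ac sA].
exists (z m |: A :\ z m.-1)%SET.
  apply: leq_trans Ac; have [mA|mA] := boolP (z m \in A).
    apply: subset_leq_card; apply/fintype.subsetP => a.
    by rewrite !inE => /orP[/eqP -> //|/andP[]].
  have m1A : z m.-1 \in A.
    have := fintype.subsetP sA _ ms; rewrite inE (negPf mA) /=.
    case/imsetP => a aA /eqP; rewrite -[in z m](prednK m0) -ordS_inZp => /eqP.
    by move/(bij_inj (@ordS_bij n)) ->.
  by rewrite cardsU1 (cardsD1 (z m.-1) A) m1A leq_add2r; case: (_ \in _).
apply/fintype.subsetP => t; rewrite !inE => /orP[/eqP ->|/andP[tm ts]].
  by apply/orP; right; apply/imsetP; exists (z m); rewrite ?ordS_inZp// !inE eqxx.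
have := fintype.subsetP sA _ ts; rewrite !inE tm => /orP[->|]; first by rewrite orbT.
case/imsetP => a aA ->; have [->|am] := eqVneq a (z m.-1).
  by rewrite ordS_inZp prednK// eqxx.
by apply/orP; right; apply/imsetP; exists a => //; rewrite !inE am aA orbT.
Qed.

(** The end points q and q + c are left free so that gaps pass to subsets. *)
Definition gap s q c : Prop := forall m, 0 < m < c -> z (q + m) \notin s.

Lemma gap_sub s t q c d : t \subset s -> d <= c -> gap s q c -> gap t q d.
Proof.
move=> ts dc g m /andP[m0 md]; apply: (contra (fintype.subsetP ts _)); apply: g.
by rewrite m0 (leq_trans md).
Qed.

Lemma gap_mod s a b c : a = b %[mod n] -> gap s a c -> gap s b c.
Proof.
move=> ab g m mc; have -> : z (b + m) = z (a + m).
  by apply/eqP; rewrite inZp_eq eqn_modDr ab.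
exact: g.
Qed.

Lemma gap_setU1 s a b c : b <= a < b + n -> b + c <= a ->
  gap s b c -> gap (z a |: s)%SET b c.
Proof.
move=> ban bca g m mc; rewrite in_setU1 negb_or g// andbT.
by rewrite eq_sym inZp_neq//; lia.
Qed.

(** Facets are adjoined in the order of their starting point x, so during the
sweep for h a gap of length h already suffices when it starts before x, and
length h + 1 is required otherwise. *)
Definition gap_bound h x q : nat := h + (x <= q %% n).

Definition stage h x : set {set 'I_n} :=
  [set s | edge_coverable l.+1 s \/ exists q, gap s q (gap_bound h x q)].

Lemma stage_down_closed h x : down_closed (stage h x).
Proof.
move=> s t [Gs|[q gq]] ts; [left; exact: edge_coverable_sub ts | right].
by exists q; exact: gap_sub gq.
Qed.

Lemma stage0 h x : stage h x finset.set0.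
Proof.
by left; exists finset.set0; rewrite ?cards0// finset.sub0set.
Qed.

Lemma stage_sub h x : stage h x `<=` stage h x.+1.
Proof.
move=> s [Gs|[q gq]]; [by left | right; exists q; apply: gap_sub gq => //].
by rewrite leq_add2l; case: leqP => //= /ltnW ->.
Qed.

Lemma stageS h : stage h.+1 n = stage h 0.
Proof.
by apply/seteqP; split=> s [Gs|[q gq]]; (try by left); right; exists q;
  move: gq; rewrite /gap_bound leq0n (_ : n <= q %% n = false) ?addn0 ?addn1//;
  rewrite leqNgt ltn_pmod.
Qed.

(** * Adjoining one facet *)

Section Step.
Variables (h x : nat).
Hypotheses (h2 : 1 < h) (hn : h < n) (xn : x < n).
Let len := gap_bound h x.

Lemma len_ge q : h <= len q. Proof. exact: leq_addr. Qed.
Lemma len_le q : len q <= h.+1.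
Proof. by rewrite /len /gap_bound; case: (x <= _) => /=; lia. Qed.

Lemma stepS s : stage h x.+1 s <-> stage h x s \/ gap s x h.
Proof.
split=> [[Gs|[q gq]]|[|gx]]; first by left; left.
- have [qx|qx] := eqVneq (q %% n) x.
    right; apply: (@gap_mod s q); first by rewrite qx modn_small.
    by move: gq; rewrite /gap_bound qx ltnn addn0.
  left; right; exists q; move: gq.
  by rewrite /gap_bound ltn_neqAle eq_sym qx.
- exact: stage_sub.
- right; exists x; move: gx.
  by rewrite /gap_bound modn_small// ltnn addn0.
Qed.

Lemma mod_window a : x < a < x + n -> a %% n != x.
Proof. by move=> /inZp_neq; rewrite inZp_eq (modn_small xn). Qed.

Lemma len_S q : q.+1 %% n != x -> len q.+1 <= len q.
Proof.
rewrite /len /gap_bound leq_add2l modnS.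
by case: ifP => _; lia.
Qed.

(** The left ends of the greedy edges of a set that resists all toggles: the
gap after an edge {q, q + 1} must be too long when it starts at q but not when it
starts at q + 1, and this forces the next left end to be q + len q. *)
Fixpoint chain j : nat := if j is i.+1 then chain i + len (chain i) else x + h.
Let q := chain.
Let p j := z (q j).+1.

Lemma chainS j : q j.+1 = q j + len (q j). Proof. by []. Qed.

Lemma chain_ltS j : (q j).+1 < q j.+1.
Proof. by rewrite chainS; have := len_ge (q j); lia. Qed.

Lemma chain_mono i j : i < j -> (q i).+1 < q j.
Proof.
elim: j => // j IH; rewrite ltnS leq_eqVlt => /orP[/eqP ->|/IH]; first exact: chain_ltS.
by have := chain_ltS j; lia.
Qed.

Lemma chain_ge j : x + j.+1 * h <= q j.
Proof.
elim: j => [|j IH]; first by rewrite mul1n.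
by rewrite chainS; have := len_ge (q j); rewrite [j.+2 * h]mulSn; lia.
Qed.

Lemma chain_gt j : x < q j.
Proof. by have := chain_ge j; rewrite mulSn; lia. Qed.

Lemma z_window a b : x <= a -> a < b -> b < x + n -> z b != z a.
Proof. by move=> xa ab bn; apply: inZp_neq; lia. Qed.

(** What the failed toggles reveal about s: from x up to chain i it consists of
points of the chain and possibly of their successors. *)
Definition tracks s i : Prop :=
  [/\ gap s x h, forall j, j <= i -> z (q j) \in s &
      forall j, j < i -> gap (s :\ p j)%SET (q j) (len (q j))].

(** The edge that covers q i can be chosen to be {q i, p i}, since the greedy
covering is optimal.  Shifting it to this place may uncover p i.-1, which is then
covered by the same argument one step earlier on the chain; for i = 0 the edge
would have to come from inside the gap that starts at x. *)
Lemma tracks_edge_coverable s i : tracks s i -> (q i).+1 < x + n ->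
  edge_coverable l.+1 s -> edge_coverable l.+1 (p i |: s)%SET.
Proof.
elim: i s => [|i IH] s [gx qs gs] pn cs.
  have := edge_shift (m := q 0) _ (qs 0 (leqnn 0)) cs.
  move=> /(_ (leq_ltn_trans (leq0n _) (chain_gt 0))) cs0; apply: (edge_coverable_sub cs0).
  apply: finset.setUS; rewrite finset.subsetD1 fintype.subxx /=.
  have -> : (q 0).-1 = x + h.-1 by rewrite /q /=; lia.
  by apply: gx; lia.
have lti j : j < i.+1 -> (q j).+1 < q i.+1 by move=> ji; exact: chain_mono.
pose t := ((p i.+1 |: s) :\ p i)%SET.
have qp j : j <= i -> z (q j) != p i.
  move=> ji; rewrite eq_sym z_window//; first exact/ltnW/chain_gt.
    by move: ji; rewrite leq_eqVlt => /orP[/eqP -> //|/chain_mono]; rewrite -/(q i); lia.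
  by have := lti i (leqnn _); lia.
have ft : tracks t i.
  split.
  - apply: (@gap_sub (p i.+1 |: s)%SET _ _ h) => //; first exact: finset.subD1set.
    by apply: gap_setU1 => //; have := chain_ge i.+1; rewrite -/(q i.+1) mulSn; lia.
  - by move=> j ji; rewrite !inE qp// qs ?orbT// leqW.
  - move=> j ji; apply: (@gap_sub (p i.+1 |: (s :\ p j))%SET _ _ (len (q j))) => //.
      by apply/fintype.subsetP => u; rewrite !inE; case: (u == p i.+1);
        case: (u == p j); case: (u \in s); rewrite ?andbF.
    apply: gap_setU1; last by apply: gs; exact: leqW.
      by have := lti j (leqW ji); have := chain_gt j; rewrite -/(q j); lia.
    by rewrite -chainS -/(q j.+1); have := lti j.+1 ji; lia.
have ct : edge_coverable l.+1 t.
  have := edge_shift (m := q i.+1) _ (qs _ (leqnn _)) cs.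
  move=> /(_ (leq_ltn_trans (leq0n _) (chain_gt _))) ct; apply: (edge_coverable_sub ct).
  apply/fintype.subsetP => u; rewrite !inE => /andP[upi /orP[-> //|us]].
  rewrite us andbT; apply/orP; right; apply/eqP => uq.
  have := gs i (leqnn _) (len (q i)).-1; have := len_ge (q i).
  rewrite !inE; have -> : q i + (len (q i)).-1 = (q i.+1).-1.
    by have := len_ge (q i); rewrite chainS; lia.
  by rewrite -uq us upi /= => hl bad; suff : false by []; apply: bad; lia.
have pin : (q i).+1 < x + n by have := lti i (leqnn _); lia.
apply: (edge_coverable_sub (IH t ft pin ct)); apply/fintype.subsetP => u.
by rewrite /t !inE; case: (u == p i).
Qed.

Lemma tracks0 s : ~ stage h x s -> gap s x h -> tracks s 0.
Proof.
move=> nKs gx; split=> // j; rewrite leqn0 => /eqP ->.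
apply: contrapT => /negP qs; apply: nKs; right; exists x => m.
rewrite /gap_bound modn_small// leqnn addn1 ltnS => /andP[m0].
by rewrite leq_eqVlt => /orP[/eqP -> //|mh]; apply: gx; rewrite m0.
Qed.

(** That p i cannot be toggled determines s up to the next point of the chain:
removing p i must create a gap that is too long, hence one that starts at q i and
reaches q i.+1, and it can reach no further because s itself has no such gap
starting at p i. *)
Lemma tracksS s i : ~ stage h x s -> tracks s i -> (q i).+1 < x + n ->
  stage h x (s :\ p i)%SET -> p i \in s /\ tracks s i.+1.
Proof.
move=> nKs fs pn Kp; have [gx qs gs] := fs.
have ps : p i \in s.
  apply: contrapT => /negP ps; apply: nKs.
  suff -> : s = (s :\ p i)%SET by [].
  by apply/setP => u; rewrite !inE; case: eqVneq => //= ->; rewrite (negPf ps).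
have qx : x < q i := chain_gt i.
have pq : p i != z (q i) by apply: z_window; lia.
have gp : gap (s :\ p i)%SET (q i) (len (q i)).
  case: Kp => [cp|[y gy]].
    exfalso; apply: nKs; left.
    rewrite -(finset.setD1K ps); apply: tracks_edge_coverable => //.
    split.
    - exact: gap_sub (finset.subD1set _ _) (leqnn _) gx.
    - move=> j ji; rewrite !inE qs// andbT eq_sym.
      move: ji; rewrite leq_eqVlt => /orP[/eqP -> //|/chain_mono].
      by rewrite -/(q i) -/(q j) => ji; have := chain_gt j; rewrite -/(q j) => qj;
        apply: z_window; lia.
    - move=> j ji; apply: gap_sub (finset.setSD _ (finset.subD1set _ _)) (leqnn _) _.
      exact: gs.
  have [m my mp] : exists2 m, 0 < m < gap_bound h x y & z (y + m) = p i.
    apply: contrapT => nm; apply: nKs; right; exists y => m my.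
    apply/negP => ms; have /negP := gy m my; apply; rewrite !inE ms andbT.
    by apply/eqP => mp; apply: nm; exists m.
  have yq : y + m.-1 = q i %[mod n].
    apply/eqP; rewrite -(eqn_modDr 1) !addn1.
    by have := eqxx (p i); rewrite -{1}mp inZp_eq -addnS prednK//; case/andP: my.
  (* the gap starts at q i and not earlier, because q i belongs to s *)
  have m1 : m = 1.
    apply/eqP; rewrite eqn_leq; case/andP: (my) => -> mlt; rewrite andbT leqNgt.
    apply/negP => m1; have := gy m.-1.
    have -> : z (y + m.-1) = z (q i) by apply/eqP; rewrite inZp_eq yq.
    rewrite !inE eq_sym pq qs// => bad; suff : false by [].
    by apply: bad; lia.
  move: yq; rewrite m1 addn0 => yq.
  have -> : len (q i) = gap_bound h x y by rewrite /len /gap_bound yq.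
  exact: gap_mod yq gy.
split=> //; split=> //.
- move=> j; rewrite leq_eqVlt => /orP[/eqP ->|]; last exact: qs.
  apply: contrapT => /negP qs'; apply: nKs; right; exists (q i).+1 => m /andP[m0 ml].
  have := len_S (mod_window (a := (q i).+1) _); rewrite -/(q i) => /(_ ltac:(lia)) ll.
  have := leq_trans ml ll; rewrite addSnnS leq_eqVlt => /orP[/eqP mq|mq].
    by rewrite mq -chainS.
  have := gp m.+1; rewrite mq => /(_ isT); rewrite !inE negb_and negbK.
  case/orP => //; rewrite addnS -addSn /p => /eqP e.
  have : z ((q i).+1 + m) != z (q i).+1.
    by apply: inZp_neq; have := len_le (q i); lia.
  by rewrite e eqxx.
- move=> j; rewrite ltnS leq_eqVlt => /orP[/eqP -> //|]; exact: gs.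
Qed.

Lemma tracks_chain s j : ~ stage h x s -> gap s x h ->
  (forall i, i < j -> (q i).+1 < x + n) ->
  (forall i, i < j -> stage h x (s :\ p i)%SET) -> tracks s j.
Proof.
move=> nKs gx; elim: j => [|j IH] pn Kp; first exact: tracks0.
have fj : tracks s j by apply: IH => i ij; [apply: pn | apply: Kp]; exact: leqW.
by have [] := tracksS nKs fj (pn _ (leqnn _)) (Kp _ (leqnn _)).
Qed.

(** Otherwise the gap at x extends to the left, and starts at x + N = x - 1. *)
Lemma start_mem s : ~ stage h x s -> gap s x h -> z x \in s.
Proof.
move=> nKs gx; apply: contrapT => /negP xs; apply: nKs; right.
exists (x + N) => m /andP[m0 ml].
have := leq_trans ml (len_le (x + N)); rewrite ltnS => mh.
have -> : z (x + N + m) = z (x + m.-1).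
  rewrite -(inZp_addn (x + m.-1) 1) mul1n; congr (z _); rewrite /n; lia.
case: m m0 {ml} mh => // -[|m] _ mh; first by rewrite addn0.
by apply: gx; rewrite /=; lia.
Qed.

Lemma tracks_subset s j : tracks s j ->
  (forall i, i < j -> (q i).+1 < x + n) ->
  forall m, x < m < q j -> z m \in s -> exists2 i, i < j & z m = z (q i) \/ z m = p i.
Proof.
move=> [gx qs gs] pn; elim: j {qs} gs pn => [|j IH] gs pn m /andP[xm mq] ms.
  have /negP[] := gx (m - x) ltac:(move: mq; rewrite /q /=; lia).
  by rewrite (subnKC (ltnW xm)).
have [mj|jm] := ltnP m (q j).
  have [|||i ij e] := IH _ _ m _ ms.
  - by move=> i ij; apply: gs; exact: leqW.
  - by move=> i ij; apply: pn; exact: leqW.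
  - by rewrite xm.
  - by exists i => //; exact: leqW.
exists j => //; move: jm; rewrite leq_eqVlt => /orP[/eqP -> |jm]; first by left.
right; apply/eqP; have := gs j (leqnn _) (m - q j).
rewrite (subnKC (ltnW jm)) !inE ms andbT negbK; apply.
by move: mq; rewrite chainS -/(q j); lia.
Qed.

Hypothesis nlh : n < l.+2 * h.

(** A set that resists all toggles is covered by the edges {q i, p i} for i <= j;
as q j >= x + (j+1) h still fits into one turn of length n < (l+2) h, there are at
most l + 1 of them. *)
Lemma chain_exhausts s j : gap s x h -> (forall i, i < j -> (q i).+1 < x + n) ->
  x + n <= (q j).+1 -> (forall i, i < j -> stage h x (s :\ p i)%SET) ->
  stage h x s.
Proof.
move=> gx pn qn Kp; apply: contrapT => nKs.
have fs := tracks_chain nKs gx pn Kp; have [_ qs gs] := fs.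
have xs := start_mem nKs gx.
have qjn : q j <= x + n.
  case: j pn qn Kp fs qs gs => [|j] pn _ _ _ _ gs; first by rewrite /q /=; lia.
  rewrite leqNgt; apply/negP => qj; have pj := pn j (leqnn _).
  have := gs j (leqnn _) (x + n - q j).
  rewrite subnKC; last by lia.
  have -> : z (x + n) = z x by rewrite -(inZp_addn x 1) mul1n.
  rewrite !inE xs andbT negbK => H.
  have xp : z x != p j.
    by rewrite eq_sym; apply: inZp_neq; have := chain_gt j; rewrite -/(q j); lia.
  by have := H ltac:(move: qj; rewrite chainS -/(q j); lia); rewrite (negPf xp).
apply: nKs; left.
exists [set z (q (i : 'I_j.+1)) | i in 'I_j.+1]%SET.
  apply: leq_trans (leq_imset_card _ _) _; rewrite card_ord.
  have := chain_ge j; rewrite -/(q j) => qg.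
  have : j.+1 * h < l.+2 * h by lia.
  by rewrite ltn_mul2r => /andP[].
apply/fintype.subsetP => u us.
have [m mx um] : exists2 m, x < m <= x + n & u = z m.
  have [ux|xu] := leqP u x.
    exists (u + n); first by have := ltn_ord u; rewrite -/n; lia.
    by apply: val_inj; rewrite /= modnDr modn_small.
  exists u; first by have := ltn_ord u; rewrite -/n; lia.
  by apply: val_inj; rewrite /= modn_small.
set A := imset _ _.
have span i : i <= j -> z (q i) \in edge_span A /\ p i \in edge_span A.
  rewrite -ltnS => ij.
  have qA : z (q i) \in A by apply/imsetP; exists (Ordinal ij).
  by split; rewrite inE ?qA//; apply/orP; right; apply/imsetP; exists (z (q i));
    rewrite // ordS_inZp.
rewrite um; rewrite um in us.
have [mj|jm] := ltnP m (q j).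
  have [|i ij [->|->]] := tracks_subset fs pn (m := m) _ us; first by lia.
    by have [] := span i (ltnW ij).
  by have [] := span i (ltnW ij).
have [->|->] : m = q j \/ m = (q j).+1 by lia.
  by have [] := span j (leqnn _).
by have [] := span j (leqnn _).
Qed.

End Step.

(** M j consists of the sets that remain after collapsing the toggles of the
first j points p i; toggling p j collapses M j onto M j.+1, because p j lies
outside the gaps that witness the failure of the earlier toggles. *)
Lemma stage_collapse (R : realType) h x : 1 < h -> h < n -> x < n ->
  n < l.+2 * h ->
  deformation_retract R (stage h x) (stage h x.+1).
Proof.
move=> h2 hn xn nlh.
pose q := chain h x; pose p j := z (q j).+1.
pose M j := [set s | stage h x.+1 s /\ forall i, i < j -> stage h x (s :\ p i)%SET].
have MS j : M j.+1 `<=` M j.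
  by move=> s [Ls Ks]; split=> // i ij; apply: Ks; exact: leqW.
have dM j : down_closed (M j).
  move=> s t [Ls Ks] ts; split; first exact: stage_down_closed Ls ts.
  by move=> i /Ks K; apply: stage_down_closed K _; exact: finset.setSD.
have KM j : stage h x `<=` M j.
  move=> s Ks; split; first exact: stage_sub.
  by move=> i _; apply: stage_down_closed Ks (finset.subD1set _ _).
have retr j : (forall i, i < j -> (q i).+1 < x + n) ->
    deformation_retract R (M j) (stage h x.+1).
  elim: j => [|j IH] pn.
    have -> : M 0 = stage h x.+1 by apply/seteqP; split=> s; [case | ].
    exact: deformation_retract_refl.
  apply: deformation_retract_trans (IH _); last by move=> i ij; apply: pn; exact: leqW.
  apply: (@toggle_collapse _ _ _ _ (p j)) => //.
    by apply: KM; exact: stage0.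
  move=> s [Ls Ks] nMs.
  have nKp : ~ stage h x (s :\ p j)%SET.
    move=> Kp; apply: nMs; split=> // i; rewrite ltnS leq_eqVlt.
    by case/orP => [/eqP -> //|]; exact: Ks.
  have nKs : ~ stage h x s.
    by move=> K; apply: nKp; apply: stage_down_closed K (finset.subD1set _ _).
  split; last first.
    move=> [_ /(_ j (leqnn _))]; suff -> : (s :\ p j :\ p j = s :\ p j)%SET by [].
    by apply/setP => u; rewrite !inE; case: eqP.
  have gx : gap s x h by case/stepS: Ls.
  have pnj := pn j (leqnn _).
  have qj : x + j.+1 * h <= q j by apply: chain_ge.
  have [_ _ gs] : tracks h x s j.
    by apply: tracks_chain => // i ij; apply: pn; exact: leqW.
  split.
    move: qj; rewrite mulSn => qj.
    by apply/stepS => //; right; apply: gap_setU1 => //; lia.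
  move=> i ij; right; exists (q i).
  apply: (@gap_sub (p j |: (s :\ p i))%SET _ _ (gap_bound h x (q i))) => //.
    by apply/fintype.subsetP => u; rewrite !inE; case: (u == p j);
      case: (u == p i); case: (u \in s).
  have qi : x < q i by apply: chain_gt.
  have qij : q i.+1 <= (q j).+1.
    move: ij; rewrite leq_eqVlt => /orP[/eqP ->|ij]; first exact: leqnSn.
    have iq : (q i.+1).+1 < q j by apply: chain_mono.
    exact: leqW (ltnW (ltnW iq)).
  have bnd : q i <= (q j).+1 < q i + n.
    have qlt : (q i).+1 < q j by apply: chain_mono.
    move: qlt qi pnj; move: (q i) (q j) => a b; clear; lia.
  have qS : q i.+1 = q i + gap_bound h x (q i) by [].
  apply: gap_setU1; [exact: bnd | by rewrite -qS | exact: gs].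
have exj : exists j, x + n <= (q j).+1.
  exists n; have : x + n.+1 * h <= q n by apply: chain_ge.
  have := leq_mul (leqnn n.+1) (ltnW h2); rewrite muln1.
  by move: (n.+1 * h) (q n) => a b; clear; lia.
case: (ex_minnP exj) => j qn jmin.
have pn i : i < j -> (q i).+1 < x + n.
  by move=> ij; rewrite ltnNge; apply/negP => /jmin; rewrite leqNgt ij.
suff -> : stage h x = M j by exact: retr.
apply/seteqP; split; first exact: KM.
move=> s [Ls Ks]; have [//|gx] : stage h x s \/ gap s x h by apply/stepS.
by apply: chain_exhausts gx pn qn Ks => //.
Qed.

End Stages.

(** * Gale's evenness condition *)

(** The sum is the coefficient of degree #|B| - 1 of the polynomial that
interpolates Q at the points c b, that is, of Q itself,
whose degree is smaller. *)
Lemma lagrange_sum_eq0 (F : fieldType) (T : finType) (B : {set T}) (c : T -> F)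
    (Q : {poly F}) : {in B &, injective c} -> (size Q < #|B|)%N ->
  \sum_(b in B) Q.[c b] / \prod_(b' in B | b' != b) (c b - c b') = 0.
Proof.
move=> cI QB; pose D b := \prod_(b' in B | b' != b) (c b - c b').
pose L b : {poly F} := \prod_(b' in B | b' != b) ('X - (c b')%:P).
pose P := \sum_(b in B) (Q.[c b] / D b) *: L b.
have D0 b : b \in B -> D b != 0.
  move=> bB; apply/prodf_neq0 => b' /andP[b'B bb].
  by rewrite subr_eq0 eq_sym; apply: contra bb => /eqP /cI ->.
have szL b : b \in B -> size (L b) = #|B|.
  move=> bB; rewrite size_prod => [|b' _]; last by rewrite polyXsubC_eq0.
  under eq_bigr do rewrite size_XsubC.
  rewrite sum_nat_const (cardD1 b B) bB.
  set k := #|_|; have -> : k = #|[predD1 B & b]|.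
    by apply: eq_card => u; rewrite !inE andbC.
  lia.
have mL b : L b \is monic by apply: monic_prod => b' _; exact: monicXsubC.
have PQ : P - Q = 0.
  apply: (@roots_geq_poly_eq0 _ _ [seq c b | b in B]).
  - apply/allP => _ /fintype.imageP[b bB ->].
    rewrite rootE !hornerE horner_sum (bigD1 b)//= big1 ?addr0 => [|b' /andP[b'B bb]].
      rewrite hornerZ horner_prod; under eq_bigr do rewrite hornerXsubC.
      by rewrite -/(D b) divfK ?subrr// D0.
    rewrite hornerZ horner_prod (bigD1 b)/= ?bB 1?eq_sym ?bb//.
    by rewrite hornerXsubC subrr mul0r mulr0.
  - by rewrite map_inj_in_uniq ?enum_uniq// => b b'; rewrite !mem_enum; exact: cI.
  - rewrite size_image (leq_trans (size_polyD _ _))// geq_max size_polyN.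
    apply/andP; split; last exact: ltnW.
    apply: (leq_trans (size_sum _ _ _)); apply/bigmax_leqP => b bB.
    by rewrite (leq_trans (size_scale_leq _ _))// szL.
have : P`_(#|B|.-1) = 0.
  move/eqP: PQ; rewrite subr_eq0 => /eqP ->; rewrite nth_default//.
  by rewrite -ltnS (prednK (leq_ltn_trans (leq0n _) QB)).
rewrite coef_sum => {2}<-; apply: eq_bigr => b bB.
by rewrite coefZ -(szL b bB) -[(L b)`_ _]/(lead_coef _) (monicP (mL b)) mulr1.
Qed.

Section Gale.
Variables (R : realType) (N : nat).
Let n := N.+1.
Implicit Types (a b i : 'I_n) (s A B : {set 'I_n}).

(** The edge {n-1, 0} surrounds the other grid points instead of lying on one side
of each of them. *)
Definition wrap_sign a : R := if (a == ord_max) then -1 else 1.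

Definition edge_poly a : {poly R} :=
  wrap_sign a *: (('X - (a%:R)%:P) * ('X - ((ordS a : nat)%:R)%:P)).

Lemma edge_poly_horner a i :
  (edge_poly a).[i%:R] = wrap_sign a * ((i%:R - a%:R) * (i%:R - (ordS a)%:R)).
Proof. by rewrite /edge_poly !hornerE. Qed.

Lemma wrap_sign_sqr a : wrap_sign a * wrap_sign a = 1.
Proof. by rewrite /wrap_sign; case: ifP; rewrite ?mulrNN mulr1. Qed.

Lemma val_ordS a : (ordS a : nat) = if a == ord_max then 0%N else a.+1.
Proof.
rewrite /=; case: eqVneq => [->|am]; first by rewrite /= modnn.
rewrite modn_small// ltnS ltn_neqAle -ltnS ltn_ord andbT.
by apply: contra am => /eqP aN; apply/eqP/val_inj.
Qed.

Lemma edge_poly_eq0 a i : ((edge_poly a).[i%:R] == 0) = (i == a) || (i == ordS a).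
Proof.
rewrite edge_poly_horner mulf_eq0 mulf_eq0 !subr_eq0 !eqr_nat.
have -> : (wrap_sign a == 0) = false.
  by apply/eqP => a0; have /eqP := wrap_sign_sqr a; rewrite a0 mulr0 eq_sym oner_eq0.
by [].
Qed.

Lemma edge_poly_ge0 a i : 0 <= (edge_poly a).[i%:R].
Proof.
rewrite edge_poly_horner val_ordS /wrap_sign; case: eqVneq => [->|_].
  rewrite mulN1r oppr_ge0 subr0; apply: mulr_le0_ge0 => //.
  by rewrite subr_le0 ler_nat -ltnS ltn_ord.
rewrite mul1r; have [ia|ai] := leqP i a.
  by apply: mulr_le0; rewrite subr_le0 ler_nat// ltnW.
by apply: mulr_ge0; rewrite subr_ge0 ler_nat// ltnW.
Qed.

Lemma edge_coverable_boundary c s : (2 * c < n)%N ->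
  edge_coverable c s -> cyclic_boundary_simplices R (2 * c) s.
Proof.
move=> cn [A Ac]; apply: cyclic_boundary_simplices_sub.
apply/cyclic_boundary_simplicesP; pose e := \prod_(a in A) edge_poly a.
have eE i : (e.[i%:R] == 0) = (i \in edge_span A).
  rewrite horner_prod; apply/idP/idP.
    case/prodf_eq0 => a aA; rewrite edge_poly_eq0 => /orP[|] /eqP ->;
      rewrite inE ?aA//.
    by apply/orP; right; apply/imsetP; exists a.
  rewrite inE => /orP[iA|/imsetP[a aA ia]]; apply/prodf_eq0.
    by exists i => //; rewrite edge_poly_eq0 eqxx.
  by exists a => //; rewrite edge_poly_eq0 -ia eqxx orbT.
exists (- e); split.
- rewrite size_polyN; apply: (@leq_trans (2 * #|A|).+1); last by rewrite ltnS leq_mul2l.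
  rewrite /e -sum1_card; elim/big_rec2: _ => [|a m p _ IH]; first by rewrite size_poly1.
  apply: leq_trans (size_polyMleq _ _) _.
  have sa : (size (edge_poly a) <= 3)%N.
    rewrite (leq_trans (size_scale_leq _ _))//.
    by rewrite (leq_trans (size_polyMleq _ _))// !size_XsubC.
  rewrite -subn1 leq_subLR; apply: leq_trans (leq_add sa IH) _; lia.
- move=> i; rewrite hornerN oppr_le0 horner_prod.
  by apply: prodr_ge0 => a _; exact: edge_poly_ge0.
- by move=> i; rewrite hornerN oppr_eq0 eE.
- apply/eqP => sT; have := leqnn n; rewrite -{2}(card_ord n) -cardsT -sT.
  rewrite leqNgt => /negP; apply; apply: leq_ltn_trans cn.
  apply: leq_trans (leq_card_setU _ _) _.
  by rewrite mul2n -addnn leq_add// (leq_trans (leq_imset_card _ _)).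
Qed.

(** Take every other element of each block of consecutive elements of s, beginning
with the first.  The blocks have a first element because s is proper. *)
Lemma edge_kernel s : (1 < n)%N -> s != [set: 'I_n]%SET ->
  exists B, [/\ B \subset s, forall b, b \in B -> ordS b \notin B
              & s \subset edge_span B].
Proof.
move=> n1; have [m] := ubnP #|s|; elim: m s => // m IH s; rewrite ltnS => sm sT.
have [->|[x0 x0s]] := set_0Vmem s.
  by exists finset.set0; split; rewrite ?finset.sub0set// => b; rewrite inE.
have [x xs px] : exists2 x, x \in s & forall y, ordS y = x -> y \notin s.
  apply: contrapT => nx; move/negP: sT; apply; apply/eqP/setP => y; rewrite inE.
  have step k : inZp k.+1 \in s -> (inZp k : 'I_n) \in s.
    move=> ks; apply: contrapT => /negP nk; apply: nx; exists (inZp k.+1) => // u.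
    by rewrite -ordS_inZp => /(bij_inj (@ordS_bij n)) ->.
  have steps k j : (inZp (k + j) : 'I_n) \in s -> (inZp k : 'I_n) \in s.
    by elim: j => [|j IHj]; rewrite ?addn0// addnS => /step.
  rewrite -(valZpK y); apply: (@steps y (x0 + n - y)%N).
  suff -> : (inZp (y + (x0 + n - y)) : 'I_n) = x0 by [].
  apply: val_inj; rewrite /= subnKC ?modnDr ?modn_small//.
  by rewrite (leq_trans (ltnW (ltn_ord y)))// leq_addl.
have xSx : ordS x != x.
  apply/eqP => /(congr1 val); rewrite [LHS]val_ordS; case: eqVneq => [-> /= N0|_ /eqP].
    by move: n1; rewrite /n -N0.
  by rewrite -[X in _ == X]addn0 -addn1 eqn_add2l.
have [||B [Bs Bi sB]] := IH (s :\ x :\ ordS x)%SET.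
- rewrite (leq_trans _ sm)// (cardsD1 x s) xs add1n ltnS.
  exact/subset_leq_card/finset.subD1set.
- by apply/eqP => /setP/(_ x); rewrite !inE eqxx andbF.
have BP b : b \in B -> [/\ b != ordS x, b != x & b \in s].
  by move=> /(fintype.subsetP Bs); rewrite !inE => /and3P[].
exists (x |: B)%SET; split.
- by apply/fintype.subsetP => b; rewrite !inE => /orP[/eqP -> //|/BP[]].
- move=> b; rewrite !inE => /orP[/eqP ->|bB]; rewrite negb_or.
    by rewrite xSx; apply/negP => /BP[]; rewrite eqxx.
  rewrite Bi// andbT; apply/eqP => /px; have [_ _ ->] := BP _ bB; by [].
- apply/fintype.subsetP => u us; rewrite !inE.
  have [//|ux] := eqVneq u x.
  have [->|uSx] := eqVneq u (ordS x).
    by apply/orP; right; apply/imsetP; exists x; rewrite ?inE ?eqxx.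
  have : u \in edge_span B by apply: (fintype.subsetP sB); rewrite !inE uSx ux.
  rewrite !inE => /orP[->//|/imsetP[b bB ->]].
  by apply/orP; right; apply/imsetP; exists b; rewrite // inE bB orbT.
Qed.

(** Let q expose s, and let B be a kernel of s with more than c elements.  Write
q = Q * \prod_(b in B) ('X - b) and apply the Lagrange identity to Q at the
successors of B.  Up to the common sign E, each term is q at a successor divided
by a product of values of the edge polynomials, hence nonpositive.  So Q vanishes
at #|B| points, more than its degree allows. *)
Lemma boundary_edge_coverable c s : (1 < n)%N ->
  cyclic_boundary_simplices R (2 * c) s -> edge_coverable c s.
Proof.
move=> n1 /cyclic_boundary_simplicesP[q [qd q0 qs sT]].
have [B [Bs Bi sB]] := edge_kernel n1 sT.
exists B => //; rewrite leqNgt; apply/negP => cB.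
have natI : injective (fun i : 'I_n => i%:R : R).
  by move=> i j /eqP; rewrite eqr_nat => /eqP /val_inj.
have SI : injective (fun i : 'I_n => (ordS i)%:R : R).
  by move=> i j /natI /(bij_inj (@ordS_bij n)).
have [Q qQ] : exists Q, q = Q * \prod_(b in B) ('X - (b%:R)%:P).
  have [||Q ->] := @uniq_roots_prod_XsubC _ q [seq b%:R | b : 'I_n in B].
  - apply/allP => _ /fintype.imageP[b bB ->].
    by rewrite rootE -qs; exact: (fintype.subsetP Bs).
  - by rewrite uniq_rootsE map_inj_uniq ?enum_uniq.
  by exists Q; rewrite big_map big_enum.
have [/eqP Q0|Q0] := boolP (Q == 0).
  move/negP: sT; apply; apply/eqP/setP => i.
  by rewrite qs qQ Q0 mul0r horner0 eqxx inE.
have sQ : (size Q < #|B|)%N.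
  have Bm : \prod_(b in B) ('X - (b%:R)%:P) \is @monic R.
    by apply: monic_prod => b _; exact: monicXsubC.
  move: qd; rewrite qQ size_Mmonic// -big_enum/= size_prod_XsubC -cardE; move: cB.
  move: (size Q) #|B| => u v; clear; lia.
pose D b := \prod_(b' in B | b' != b) ((ordS b)%:R - (ordS b')%:R : R).
have := lagrange_sum_eq0 (c := fun i => (ordS i)%:R) (in2W SI) sQ.
rewrite -/D => sum0.
pose E := \prod_(b in B) wrap_sign b.
pose W b := wrap_sign b * ((ordS b)%:R - b%:R)
     * \prod_(b' in B | b' != b) (edge_poly b').[(ordS b)%:R].
have pos b : b \in B -> 0 < W b.
  move=> bB; apply: mulr_gt0.
    rewrite val_ordS /wrap_sign; case: eqVneq => [->|_].
      by rewrite mulN1r sub0r opprK ltr0n.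
    by rewrite mul1r subr_gt0 ltr_nat.
  apply: prodr_gt0 => b' /andP[b'B bb]; rewrite lt_neqAle edge_poly_ge0 andbT.
  rewrite eq_sym edge_poly_eq0 negb_or; apply/andP; split.
    by apply/eqP => Sb; have := Bi _ bB; rewrite Sb b'B.
  by rewrite (inj_eq (bij_inj (@ordS_bij n))) eq_sym.
have D0 b : D b != 0.
  apply/prodf_neq0 => b' /andP[_ bb]; rewrite subr_eq0 eq_sym.
  by apply: contra bb => /eqP /SI ->.
have termE b : b \in B -> Q.[(ordS b)%:R] / D b * E = q.[(ordS b)%:R] / W b.
  move=> bB; apply: (canRL (mulfK (lt0r_neq0 (pos b bB)))).
  have -> : W b = wrap_sign b * ((ordS b)%:R - b%:R) *
      (\prod_(b' in B | b' != b) wrap_sign b' *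
        (\prod_(b' in B | b' != b) ((ordS b)%:R - b'%:R) * D b)).
    by rewrite /D -!big_split /=; congr (_ * _); apply: eq_bigr => b' _;
      rewrite edge_poly_horner.
  have -> : q.[(ordS b)%:R] = Q.[(ordS b)%:R] * (((ordS b)%:R - b%:R) *
      \prod_(b' in B | b' != b) ((ordS b)%:R - b'%:R)).
    rewrite qQ hornerM horner_prod (bigD1 b)//= hornerXsubC; congr (_ * (_ * _)).
    by apply: eq_bigr => b' _; rewrite hornerXsubC.
  rewrite /E (bigD1 b)//=.
  have KK : (\prod_(b' in B | b' != b) wrap_sign b') *
     (\prod_(b' in B | b' != b) wrap_sign b') = 1.
    by rewrite -big_split /= big1 // => b' _; exact: wrap_sign_sqr.
  have ww := wrap_sign_sqr b; have dd := mulVf (D0 b).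
  move: KK ww dd; move: (wrap_sign b) (\prod_(_ in B | _) wrap_sign _).
  move: (D b) (D b)^-1 Q.[_] ((ordS b)%:R - b%:R) (\prod_(_ in B | _) (_ - _)).
  move=> d d' v y X w K KK ww dd.
  rewrite -!mulrA [K * (w * _)]mulrCA [w * (w * _)]mulrA ww mul1r.
  rewrite [K * (y * _)]mulrCA [K * (K * _)]mulrA KK mul1r.
  by rewrite [d' * (y * _)]mulrCA [d' * (X * _)]mulrCA dd mulr1.
have E0 : E != 0.
  apply/prodf_neq0 => b _; apply/eqP => b0; have /eqP := wrap_sign_sqr b.
  by rewrite b0 mulr0 eq_sym oner_eq0.
have term0 b : b \in B -> Q.[(ordS b)%:R] = 0.
  have neg b' : b' \in B -> 0 <= - (Q.[(ordS b')%:R] / D b' * E).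
    move=> bB; rewrite termE// oppr_ge0 mulr_le0_ge0//.
    by rewrite invr_ge0 ltW// pos.
  have : \sum_(b' in B) - (Q.[(ordS b')%:R] / D b' * E) == 0.
    by rewrite sumrN -mulr_suml sum0 mul0r oppr0.
  rewrite psumr_eq0// => /allP H bB; have := H b (mem_index_enum _).
  by rewrite bB oppr_eq0 /= !mulf_eq0 (negPf E0) invr_eq0 (negPf (D0 b)) !orbF => /eqP.
move/negP: Q0; apply; apply/eqP.
apply: (@roots_geq_poly_eq0 _ _ [seq (ordS b)%:R | b : 'I_n in B]).
- by apply/allP => _ /fintype.imageP[b bB ->]; rewrite rootE term0.
- by rewrite map_inj_uniq ?enum_uniq.
- by rewrite size_image ltnW.
Qed.

End Gale.

(** * The nerve complex as a stage *)

Section NerveStages.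
Local Open Scope nat_scope.
Variables (N l : nat).
Let n := N.+1.
Implicit Types (s A : {set 'I_n}) (g k : nat).

(** An edge {a, a+1} meets the open intervals ]q, q+g[ for the g values
q = a - g + 1, ..., a only, so c edges cannot meet all n intervals. *)
Lemma edge_coverable_gap c g s : c * g < n -> edge_coverable c s ->
  exists q, gap s q g.
Proof.
move=> cgn [A Ac sA].
have [->|g0] := posnP g; first by exists 0 => m; rewrite ltn0 andbF.
pose hit := [set (inZp (u.1 + n - u.2) : 'I_n) |
    u : 'I_n * 'I_g in finset.setX A [set: 'I_g]%SET]%SET.
have [q qh] : exists q : 'I_n, q \notin hit.
  apply/existsP; rewrite -negb_forall; apply/negP => /forallP hT.
  have : #|hit| <= c * g.
    apply: leq_trans (leq_imset_card _ _) _.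
    by rewrite cardsX cardsT card_ord leq_mul2r Ac orbT.
  rewrite (_ : hit = [set: 'I_n]%SET); last by apply/setP => i; rewrite hT inE.
  by rewrite cardsT card_ord leqNgt cgn.
have hitP (a : 'I_n) m : a \in A -> m < g -> inZp (q + m) = a -> False.
  move=> aA mg qa; move/negP: qh; apply.
  apply/imsetP; exists (a, Ordinal mg); first by rewrite finset.in_setX aA inE.
  have gn : g < n.
    apply: leq_ltn_trans cgn; rewrite leq_pmull//.
    by apply: leq_trans Ac; rewrite card_gt0; apply/set0Pn; exists a.
  apply: val_inj; rewrite -qa -[LHS](modn_small (ltn_ord q)) /=.
  apply/eqP; rewrite -(eqn_modDr m) subnK ?modnDr ?modn_mod//.
  by rewrite (leq_trans (ltnW (ltn_trans mg gn)))// leq_addl.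
exists q => m /andP[m0 mg]; apply/negP => /(fintype.subsetP sA); rewrite inE.
case/orP => [qA|/imsetP[a aA qa]]; first exact: hitP qA mg _.
apply: (hitP _ m.-1 aA); first lia.
by apply: (bij_inj (@ordS_bij n)); rewrite -qa ordS_inZp -addnS prednK.
Qed.

Lemma nerveP k s : k < n ->
  simplices (nerve_complex n k) s <-> exists q, gap s q (n - k).
Proof.
move=> kn; split=> [[i si]|[q gq]].
  exists (i + k) => m mk; apply/negP => /(fintype.subsetP si).
  rewrite inE => /existsP[u /andP[iu]] /=; rewrite modn_mod => ui.
  have := ltn_ord u; rewrite ltnS => uik.
  have := @inZp_neq N u (i + k + m); rewrite inZp_eq eq_sym ui => H.
  by suff : ~~ true by []; apply: H; lia.
exists (inZp (q + (n - k))); apply/fintype.subsetP => x xs; rewrite inE.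
set i : 'I_n := inZp _.
pose j := (x + n - i) %% n.
have ij : (i + j = x %[mod n]).
  rewrite /j modnDmr subnKC ?modnDr//.
  by rewrite (leq_trans (ltnW (ltn_ord i)))// leq_addl.
have jk : j <= k.
  rewrite leqNgt; apply/negP => kj.
  have := gq (j - k); have -> : inZp (q + (j - k)) = x :> 'I_n.
    apply: val_inj; rewrite /= -(modn_small (ltn_ord x)) -ij.
    rewrite /i /= modnDml -(modnDr (q + (j - k))); congr (_ %% _); lia.
  have : j < n by rewrite ltn_pmod.
  by rewrite xs => jn H; suff : ~~ true by []; apply: H; lia.
have ik : i + j < (i + k).+1 by rewrite ltnS leq_add2l.
by apply/existsP; exists (Ordinal ik); rewrite /= leq_addr ij eqxx.
Qed.

(** A set with a gap of length n has at most one element. *)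
Lemma stage_last : stage l N 0 = @edge_coverable n l.+1.
Proof.
apply/seteqP; split=> s; last by left.
case=> // -[q]; rewrite /gap_bound leq0n addn1 => gq.
exists [set inZp q]%SET; first by rewrite cards1.
apply/fintype.subsetP => x xs; rewrite !inE.
apply: contrapT => /negP; rewrite negb_or => /andP[xq _].
pose j := (x + n - q %% n) %% n.
have qj : inZp (q + j) = x.
  apply: val_inj; rewrite /= /j modnDmr.
  have -> : q + (x + n - q %% n) = q %/ n * n + (x + n).
    by have := divn_eq q n; have := ltn_pmod q (ltn0Sn N); rewrite -/n; lia.
  by rewrite modnMDl modnDr modn_small.
have := gq j; rewrite qj xs => H; suff : ~~ true by []; apply: H.
rewrite ltn_pmod// andbT lt0n; apply: contra xq => /eqP j0.
by rewrite -qj j0 addn0.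
Qed.

Lemma stage_retract (R : realType) g : 1 < g -> g <= N -> n < l.+2 * g ->
  deformation_retract R (@edge_coverable n l.+1) (stage l g n).
Proof.
move=> g1 gN lg.
have sweep h x : g <= h <= N -> x <= n ->
    deformation_retract R (stage l h (0 : nat)) (stage (N := N) l h x).
  move=> /andP[gh hN]; elim: x => [|x IH] xn; first exact: deformation_retract_refl.
  apply: deformation_retract_trans (IH (ltnW xn)) _.
  apply: stage_collapse => //; first exact: leq_trans gh.
  by apply: (leq_trans lg); rewrite leq_mul2l gh orbT.
suff H d : d <= N - g ->
    deformation_retract R (@edge_coverable n l.+1) (stage l (N - d) n).
  by have := H (N - g) (leqnn _); rewrite subKn.
elim: d => [|d IH] dN.
  by rewrite subn0 -stage_last; apply: sweep; rewrite ?leqnn ?gN.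
apply: deformation_retract_trans (IH (ltnW dN)) _.
have -> : N - d = (N - d.+1).+1 by lia.
by rewrite stageS; apply: sweep => //; lia.
Qed.

Lemma stage_nerve k : k < n -> l.+1 * (n - k) < n ->
  stage l (n - k) n = simplices (nerve_complex n k).
Proof.
move=> kn lk; apply/seteqP; split=> s.
  move=> Ks; apply/nerveP => //; case: Ks => [/edge_coverable_gap|[q]]; first exact.
  by move=> gq; exists q; apply: gap_sub gq => //; exact: leq_addr.
move/nerveP => /(_ kn)[q gq]; right; exists q; apply: gap_sub gq => //.
by rewrite /gap_bound (_ : n <= q %% n = false) ?addn0// leqNgt ltn_pmod.
Qed.

End NerveStages.

Lemma ltr_frac_nat (a b c d : nat) : (0 < b)%N -> (0 < d)%N ->
  (a%:R / b%:R < c%:R / d%:R :> rat) = (a * d < c * b)%N.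
Proof.
move=> b0 d0; rewrite ltr_pdivrMr ?ltr0n// mulrAC ltr_pdivlMr ?ltr0n//.
by rewrite -!natrM ltr_nat.
Qed.

Theorem theorem5p9 (R : realType) (n k l : nat) (n_gt0 : (0 < n)%N)
    (lt_kn : l%:R / l.+1%:R < k%:R / n%:R :> rat)
    (gt_kn : k%:R / n%:R < l.+1%:R / l.+2%:R :> rat) :
  exists KL : simplices (cyclic_boundary_complex R (2 * l + 2) n)
                `<=` simplices (nerve_complex n k),
    homotopy_equivalence R (realization_incl R KL).
Proof.
case: n n_gt0 lt_kn gt_kn => // N _; rewrite !ltr_frac_nat// => lt_kn gt_kn.
have kn : (k < N.+1)%N.
  by rewrite ltnNge; apply/negP => nk; have := leq_mul2l l.+2 N.+1 k; lia.
pose g := (N.+1 - k)%N.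
have kE : k = (N.+1 - g)%N by rewrite /g; lia.
have lg : (l.+1 * g < N.+1)%N by rewrite /g mulnBr; lia.
have gl : (N.+1 < l.+2 * g)%N by rewrite /g mulnBr; lia.
have g1 : (1 < g)%N by case: (g) lg gl => [|[]//]; lia.
have gN : (g <= N)%N by move: lg; rewrite mulSn; lia.
have n1 : (1 < N.+1)%N by lia.
have bE : simplices (cyclic_boundary_complex R (2 * l + 2) N.+1)
    = @edge_coverable N.+1 l.+1.
  rewrite (_ : 2 * l + 2 = 2 * l.+1)%N; last lia.
  apply/seteqP; split=> s; first exact: boundary_edge_coverable.
  apply: edge_coverable_boundary; rewrite mulnC.
  by apply: leq_ltn_trans lg; rewrite leq_mul2l g1 orbT.
have ret : deformation_retract R
    (simplices (cyclic_boundary_complex R (2 * l + 2) N.+1))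
    (simplices (nerve_complex N.+1 k)).
  by rewrite bE -(stage_nerve kn lg); exact: stage_retract.
by exists ret.1; exact: homotopy_equivalence_incl.
Qed.
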